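(* Let $A$ be a commutative ring, $I$ an ideal of $A$ and $R=A\bowtie I$ the amalgamated duplication of $A$ along $I$. Then $R$ is $1$-semiregular if and only if $I$ is a pure ideal of $A$ and $A$ is $1$-semiregular.
   Context: All rings are commutative with identity and all modules are unitary. $A\bowtie I$ is the subring $\{(r,r+a)\mid r\in A,\ a\in I\}$ of $A\times A$. A ring $R$ is $1$-semiregular if every finitely presented $R$-module $M$ is $1$-periodic, i.e. there is an exact sequence $0\to M\to P\to M\to 0$ with $P$ projective. An ideal $I$ of $A$ is pure if it is a pure submodule of $A$, i.e. $0\to I\to A\to A/I\to 0$ remains exact after tensoring with any $A$-module (equivalently, $A/I$ is flat). *)

(* Defs.v *)
From HB Require Import structures.
From mathcomp Require Import all_boot all_order all_algebra.
From mathcomp Require Import boolp.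

Set Implicit Arguments.
Unset Strict Implicit.
Unset Printing Implicit Defensive.

Import GRing.Theory.
Local Open Scope ring_scope.
Local Open Scope quotient_scope.

Section Exactness.
Variable R : pzRingType.

Definition surj (U V : Type) (f : U -> V) : Prop := forall y, exists x, f x = y.

Definition exact (U V W : lmodType R) (f : {linear U -> V}) (g : {linear V -> W})
    : Prop :=
  forall y, g y = 0 <-> exists x, f x = y.

Definition short_exact (U V W : lmodType R)
    (f : {linear U -> V}) (g : {linear V -> W}) : Prop :=
  [/\ injective f, exact f g & surj g].

End Exactness.

Section Modules.
Variable R : comPzRingType.

Definition projective (P : lmodType R) : Prop :=
  forall (U V : lmodType R) (g : {linear U -> V}) (f : {linear P -> V}),
    surj g -> exists h : {linear P -> U}, forall x, g (h x) = f x.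

Definition finitely_presented (M : lmodType R) : Prop :=
  exists (m n : nat) (f : {linear 'rV[R]_m -> 'rV[R]_n})
         (g : {linear 'rV[R]_n -> M}),
    exact f g /\ surj g.

Definition one_periodic (M : lmodType R) : Prop :=
  exists (P : lmodType R) (f : {linear M -> P}) (g : {linear P -> M}),
    projective P /\ short_exact f g.

End Modules.

Definition one_semiregular (R : comPzRingType) : Prop :=
  forall M : lmodType R, finitely_presented M -> one_periodic M.

Section Submodules.
Variables (R : pzRingType) (V : lmodType R) (S : submodClosed V).

Definition submod : Type := {x : V | x \in S}.

HB.instance Definition _ := SubChoice.on submod.
HB.instance Definition _ :=
  GRing.SubChoice_isSubLmodule.Build R V (fun x => x \in S) submod
    (GRing.subsemimodClosedP S).

Definition submod_incl : {linear submod -> V} := val.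

(* mathcomp quotients are taken by a zmodClosed predicate. *)
Definition submod_mem : {pred V} := fun x => x \in S.

Fact submod_mem_zmod_closed : zmod_closed submod_mem.
Proof.
by split=> [|x y xS yS]; [exact: (rpred0 S)|rewrite -scaleN1r rpredD ?rpredZ].
Qed.

HB.instance Definition _ :=
  GRing.isZmodClosed.Build V submod_mem submod_mem_zmod_closed.

Definition quotmod : Type := (Quotient.quot submod_mem).

HB.instance Definition _ := GRing.Zmodule.on quotmod.

Definition quotmod_pi (x : V) : quotmod := \pi_(Quotient.quot submod_mem) x.

Lemma quotmod_piK (q : quotmod) : quotmod_pi (repr q) = q.
Proof. exact: reprK. Qed.

Lemma quotmod_piP (x y : V) : quotmod_pi x = quotmod_pi y <-> x - y \in S.
Proof.
rewrite (_ : (x - y \in S) = (x - y \in submod_mem)) //.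
by rewrite Quotient.idealrBE; split=> /eqP.
Qed.

Lemma quotmod_piB : zmod_morphism quotmod_pi.
Proof. by move=> x y; rewrite /quotmod_pi raddfB. Qed.

Definition quotmod_scale (a : R) (q : quotmod) : quotmod :=
  quotmod_pi (a *: repr q).

Lemma quotmod_scale_pi a x : quotmod_scale a (quotmod_pi x) = quotmod_pi (a *: x).
Proof.
apply/quotmod_piP; rewrite -scalerBr rpredZ //.
by apply/quotmod_piP; rewrite quotmod_piK.
Qed.

Let piD x y : quotmod_pi (x + y) = quotmod_pi x + quotmod_pi y.
Proof. by rewrite /quotmod_pi raddfD. Qed.

Fact quotmod_scaleA a b q :
  quotmod_scale a (quotmod_scale b q) = quotmod_scale (a * b) q.
Proof. by rewrite -(quotmod_piK q) !quotmod_scale_pi scalerA. Qed.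

Fact quotmod_scale1 : left_id 1 quotmod_scale.
Proof. by move=> q; rewrite -(quotmod_piK q) quotmod_scale_pi scale1r. Qed.

Fact quotmod_scaleDr : right_distributive quotmod_scale +%R.
Proof.
move=> a p q; rewrite -(quotmod_piK p) -(quotmod_piK q) -piD !quotmod_scale_pi.
by rewrite scalerDr piD.
Qed.

Fact quotmod_scaleDl q : {morph quotmod_scale^~ q : a b / a + b}.
Proof.
by move=> a b /=; rewrite -(quotmod_piK q) !quotmod_scale_pi scalerDl piD.
Qed.

HB.instance Definition _ := GRing.Zmodule_isLmodule.Build R quotmod
  quotmod_scaleA quotmod_scale1 quotmod_scaleDr quotmod_scaleDl.

HB.instance Definition _ :=
  GRing.isZmodMorphism.Build V quotmod quotmod_pi quotmod_piB.

HB.instance Definition _ := GRing.isScalable.Build R V quotmod *:%R quotmod_pi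
  (fun a x => esym (quotmod_scale_pi a x)).

Definition quotmod_proj : {linear V -> quotmod} := quotmod_pi.

Lemma submod_quotmod_exact : short_exact submod_incl quotmod_proj.
Proof.
split=> [|y|q]; first exact: val_inj.
  rewrite -(raddf0 quotmod_proj); split=> [/quotmod_piP|[x <-]].
    by rewrite subr0 => yS; exists (exist _ y yS).
  by apply/quotmod_piP; rewrite subr0 (valP x).
by exists (repr q); exact: quotmod_piK.
Qed.

End Submodules.

(* M (x) N is the set of formal sums of pairs (m, n), encoded as lists, modulo
   the congruence generated by commutativity and the bilinearity relations;
   opposites come from (- m, n), so no formal differences are needed. *)
Section Tensor.
Variables (A : comPzRingType) (M N : lmodType A).

Inductive tensor_rel : seq (M * N) -> seq (M * N) -> Prop :=
| tensor_refl s : tensor_rel s s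
| tensor_sym s t : tensor_rel s t -> tensor_rel t s
| tensor_trans s t u : tensor_rel s t -> tensor_rel t u -> tensor_rel s u
| tensor_cat s s' t t' :
    tensor_rel s s' -> tensor_rel t t' -> tensor_rel (s ++ t) (s' ++ t')
| tensor_catC s t : tensor_rel (s ++ t) (t ++ s)
| tensor_0l n : tensor_rel [:: (0, n)] [::]
| tensor_Dl m m' n : tensor_rel [:: (m + m', n)] [:: (m, n); (m', n)]
| tensor_Dr m n n' : tensor_rel [:: (m, n + n')] [:: (m, n); (m, n')]
| tensor_Z a m n : tensor_rel [:: (a *: m, n)] [:: (m, a *: n)].

Definition tensor_relb (s t : seq (M * N)) : bool := `[< tensor_rel s t >].

Fact tensor_relb_equiv : equiv_class_of tensor_relb.
Proof.
split=> [s|s t|t s u]; first exact/asboolP/tensor_refl.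
  by apply/asboolP/asboolP; exact: tensor_sym.
by move=> /asboolP st /asboolP tu; apply/asboolP/(tensor_trans st tu).
Qed.

Canonical tensor_equiv := EquivRelPack tensor_relb_equiv.
Canonical tensor_encModRel := defaultEncModRel tensor_relb.

Definition tensor : Type := {eq_quot tensor_relb}.
HB.instance Definition _ := Choice.on tensor.

Definition tensor_pi (s : seq (M * N)) : tensor := \pi_{eq_quot tensor_relb} s.

Lemma tensor_piP s t : tensor_pi s = tensor_pi t <-> tensor_rel s t.
Proof.
split=> [|st]; last by apply/eqP; rewrite /tensor_pi piE; apply/asboolP.
by move/eqP; rewrite /tensor_pi piE => /asboolP.
Qed.

Definition tensor_repr (x : tensor) : seq (M * N) := repr x.

Lemma tensor_piK x : tensor_pi (tensor_repr x) = x.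
Proof. exact: reprK. Qed.

Lemma tensor_reprK s : tensor_rel (tensor_repr (tensor_pi s)) s.
Proof. by apply/tensor_piP; rewrite tensor_piK. Qed.

Let scale_seq (a : A) (s : seq (M * N)) := [seq (a *: p.1, p.2) | p <- s].

Let scale_seq_rel a s t :
  tensor_rel s t -> tensor_rel (scale_seq a s) (scale_seq a t).
Proof.
elim=> {s t}.
- by move=> s; exact: tensor_refl.
- by move=> s t _; exact: tensor_sym.
- by move=> s t u _ st _; exact: tensor_trans.
- by move=> s s' t t' _ ss' _ tt'; rewrite /scale_seq !map_cat; exact: tensor_cat.
- by move=> s t; rewrite /scale_seq !map_cat; exact: tensor_catC.
- by move=> n /=; rewrite scaler0; exact: tensor_0l.
- by move=> m m' n /=; rewrite scalerDr; exact: tensor_Dl.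
- by move=> m n n' /=; exact: tensor_Dr.
- move=> b m n /=; rewrite scalerA mulrC -scalerA; exact: tensor_Z.
Qed.

Definition tensor_add (x y : tensor) : tensor :=
  tensor_pi (tensor_repr x ++ tensor_repr y).
Definition tensor_scale (a : A) (x : tensor) : tensor :=
  tensor_pi [seq (a *: p.1, p.2) | p <- tensor_repr x].
Definition tensor_opp (x : tensor) : tensor := tensor_scale (- 1) x.

Let add_pi s t : tensor_add (tensor_pi s) (tensor_pi t) = tensor_pi (s ++ t).
Proof. by apply/tensor_piP/tensor_cat; exact: tensor_reprK. Qed.

Let scale_pi a s : tensor_scale a (tensor_pi s) = tensor_pi (scale_seq a s).
Proof. by apply/tensor_piP/scale_seq_rel; exact: tensor_reprK. Qed.

Fact tensor_addA : associative tensor_add.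
Proof.
move=> x y z; rewrite -(tensor_piK x) -(tensor_piK y) -(tensor_piK z).
by rewrite !add_pi catA.
Qed.

Fact tensor_addC : commutative tensor_add.
Proof.
move=> x y; rewrite -(tensor_piK x) -(tensor_piK y) !add_pi.
exact/tensor_piP/tensor_catC.
Qed.

Fact tensor_add0 : left_id (tensor_pi [::]) tensor_add.
Proof. by move=> x; rewrite -(tensor_piK x) add_pi. Qed.

Let scale_cons a p s : scale_seq a (p :: s) = (a *: p.1, p.2) :: scale_seq a s.
Proof. by []. Qed.

Let scaleDl_seq a b s :
  tensor_rel (scale_seq (a + b) s) (scale_seq a s ++ scale_seq b s).
Proof.
elim: s => [|[m n] s IH]; first exact: tensor_refl.
rewrite !scale_cons /= scalerDl -[_ :: scale_seq (a + b) s]cat1s.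
apply: tensor_trans (tensor_cat (tensor_Dl _ _ _) IH) _.
apply: (@tensor_cat [:: (a *: m, n)] [:: (a *: m, n)]
  ((b *: m, n) :: scale_seq a s ++ scale_seq b s)
  (scale_seq a s ++ (b *: m, n) :: scale_seq b s)); first exact: tensor_refl.
rewrite -cat_cons -cat1s -[_ :: scale_seq b s]cat1s [X in tensor_rel _ X]catA.
by apply: tensor_cat; [exact: tensor_catC|exact: tensor_refl].
Qed.

Let scale0_seq s : tensor_rel (scale_seq 0 s) [::].
Proof.
elim: s => [|[m n] s IH]; first exact: tensor_refl.
rewrite scale_cons /= scale0r -cat1s.
exact: tensor_trans (tensor_cat (tensor_0l n) (tensor_refl _)) IH.
Qed.

Fact tensor_scale1 : left_id 1 tensor_scale.
Proof.
move=> x; rewrite -(tensor_piK x) scale_pi; congr tensor_pi.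
by rewrite /scale_seq -[RHS]map_id; apply: eq_map => -[m n] /=; rewrite scale1r.
Qed.

Fact tensor_scaleDl_add x a b :
  tensor_scale (a + b) x = tensor_add (tensor_scale a x) (tensor_scale b x).
Proof.
rewrite -(tensor_piK x) !scale_pi add_pi; exact/tensor_piP/scaleDl_seq.
Qed.

Fact tensor_addN : left_inverse (tensor_pi [::]) tensor_opp tensor_add.
Proof.
move=> x; rewrite -{2}(tensor_scale1 x) -tensor_scaleDl_add addNr.
by rewrite -(tensor_piK x) scale_pi; apply/tensor_piP/scale0_seq.
Qed.

HB.instance Definition _ :=
  GRing.isZmodule.Build tensor tensor_addA tensor_addC tensor_add0 tensor_addN.

Fact tensor_scaleA a b x :
  tensor_scale a (tensor_scale b x) = tensor_scale (a * b) x.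
Proof.
rewrite -(tensor_piK x) !scale_pi; congr tensor_pi; rewrite /scale_seq -map_comp.
by apply: eq_map => -[m n] /=; rewrite scalerA.
Qed.

Fact tensor_scaleDr : right_distributive tensor_scale +%R.
Proof.
move=> a x y; rewrite -[_ + _]/(tensor_add x y) -[RHS]/(tensor_add _ _).
rewrite -(tensor_piK x) -(tensor_piK y) add_pi !scale_pi add_pi.
by rewrite /scale_seq map_cat.
Qed.

Fact tensor_scaleDl x : {morph tensor_scale^~ x : a b / a + b}.
Proof. by move=> a b; exact: tensor_scaleDl_add. Qed.

HB.instance Definition _ := GRing.Zmodule_isLmodule.Build A tensor
  tensor_scaleA tensor_scale1 tensor_scaleDr tensor_scaleDl.

Definition tens (m : M) (n : N) : tensor := tensor_pi [:: (m, n)].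

Lemma tens_linearl n : linear (fun m => tens m n).
Proof.
move=> a m m'; rewrite -[RHS]/(tensor_add (tensor_scale a _) _) /tens scale_pi add_pi /=.
exact/tensor_piP/tensor_Dl.
Qed.

Lemma tens_linearr m : linear (tens m).
Proof.
move=> a n n'; rewrite -[RHS]/(tensor_add (tensor_scale a _) _) /tens scale_pi add_pi /=.
apply/tensor_piP; apply: tensor_trans (tensor_Dr _ _ _) _.
rewrite -cat1s -[[:: (a *: m, n); _]]cat1s.
by apply: tensor_cat; [apply: tensor_sym; exact: tensor_Z|exact: tensor_refl].
Qed.

Lemma tensor_pi_cat s t : tensor_pi (s ++ t) = tensor_pi s + tensor_pi t.
Proof. by rewrite -add_pi. Qed.

Lemma tensor_pi_scale a s :
  tensor_pi [seq (a *: p.1, p.2) | p <- s] = a *: tensor_pi s.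
Proof. by rewrite -[RHS]/(tensor_scale _ _) scale_pi. Qed.

Lemma tensor_pi_sum s : tensor_pi s = \sum_(p <- s) tens p.1 p.2.
Proof.
elim: s => [|[m n] s IH]; first by rewrite big_nil.
by rewrite big_cons -IH -cat1s tensor_pi_cat.
Qed.

Lemma tensor_sumP (x : tensor) :
  exists s : seq (M * N), x = \sum_(p <- s) tens p.1 p.2.
Proof. by exists (tensor_repr x); rewrite -tensor_pi_sum tensor_piK. Qed.

End Tensor.

Section TensorLift.
Variables (A : comPzRingType) (M N W : lmodType A) (b : M -> N -> W).
Hypothesis bl : forall n, linear (fun m => b m n).
Hypothesis br : forall m, linear (b m).

Definition tensor_lift of (forall n, linear (fun m => b m n))
    & (forall m, linear (b m)) := fun x : tensor M N =>
  \sum_(p <- tensor_repr x) b p.1 p.2.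

Local Notation lift := (tensor_lift bl br).

Let bDl m m' n : b (m + m') n = b m n + b m' n.
Proof. by have := bl n 1 m m'; rewrite !scale1r. Qed.
Let bDr m n n' : b m (n + n') = b m n + b m n'.
Proof. by have := br m 1 n n'; rewrite !scale1r. Qed.
Let b0l n : b 0 n = 0.
Proof. by apply: (addIr (b 0 n)); rewrite -bDl !add0r. Qed.
Let b0r m : b m 0 = 0.
Proof. by apply: (addIr (b m 0)); rewrite -bDr !add0r. Qed.
Let bZl a m n : b (a *: m) n = a *: b m n.
Proof. by have := bl n a m 0; rewrite b0l !addr0. Qed.
Let bZr a m n : b m (a *: n) = a *: b m n.
Proof. by have := br m a n 0; rewrite b0r !addr0. Qed.

Let sum_rel s t : tensor_rel s t ->
  \sum_(p <- s) b p.1 p.2 = \sum_(p <- t) b p.1 p.2.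
Proof.
elim=> {s t} //=.
- by move=> s t u _ -> _ ->.
- by move=> s s' t t' _ E _ E'; rewrite !big_cat /= E E'.
- by move=> s t; rewrite !big_cat /= addrC.
- by move=> n; rewrite big_seq1 big_nil b0l.
- by move=> m m' n; rewrite !big_cons !big_nil !addr0 bDl.
- by move=> m n n'; rewrite !big_cons !big_nil !addr0 bDr.
- by move=> a m n; rewrite !big_seq1 bZl bZr.
Qed.

Let lift_pi s : lift (tensor_pi s) = \sum_(p <- s) b p.1 p.2.
Proof. exact/sum_rel/tensor_reprK. Qed.

Lemma tensor_liftE m n : lift (tens m n) = b m n.
Proof. by rewrite lift_pi big_seq1. Qed.

Fact tensor_lift_linear : linear lift.
Proof.
move=> a x y; rewrite -(tensor_piK x) -(tensor_piK y).
rewrite -tensor_pi_scale -tensor_pi_cat !lift_pi big_cat big_map scaler_sumr.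
by congr (_ + _); apply: eq_bigr => p _; exact: bZl.
Qed.

HB.instance Definition _ :=
  GRing.isLinear.Build A (tensor M N) W *:%R lift tensor_lift_linear.

Lemma tensor_lift_unique (h : {linear tensor M N -> W}) :
  (forall m n, h (tens m n) = b m n) -> h =1 lift.
Proof.
move=> hE x; have [s ->] := tensor_sumP x; rewrite !linear_sum.
by apply: eq_bigr => p _; rewrite hE; apply: esym; exact: tensor_liftE.
Qed.

End TensorLift.

Section TensorMap.
Variables (A : comPzRingType) (U V : lmodType A) (f : {linear U -> V}).
Variable M : lmodType A.

Fact tensor_map_linearl (n : M) : linear (fun u => tens (f u) n).
Proof. by move=> a u u'; rewrite linearP tens_linearl. Qed.

Fact tensor_map_linearr u : linear (fun n : M => tens (f u) n).
Proof. by move=> a n n'; rewrite tens_linearr. Qed.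

Definition tensor_map : {linear tensor U M -> tensor V M} :=
  tensor_lift tensor_map_linearl tensor_map_linearr.

Lemma tensor_mapE u n : tensor_map (tens u n) = tens (f u) n.
Proof. exact: tensor_liftE. Qed.

End TensorMap.

Definition pure_submodule (A : comPzRingType) (V : lmodType A)
    (S : submodClosed V) : Prop :=
  forall M : lmodType A,
    short_exact (tensor_map (submod_incl S) M) (tensor_map (quotmod_proj S) M).

(* An ideal of A is a submodule of the regular module A^o; unlike the library's
   [idealr], it may contain 1, and A may be the zero ring. *)
Definition pure_ideal (A : comPzRingType) (I : submodClosed A^o) : Prop :=
  pure_submodule I.

Section AmalgamatedDuplication.
Variables (A : comPzRingType) (I : submodClosed A^o).

Definition amalg_dup_pred : {pred A * A} :=
  fun p => `[< exists r a : A, a \in I /\ p = (r, r + a) >].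

Lemma amalg_dup_predE p : (p \in amalg_dup_pred) = ((p.2 - p.1 : A^o) \in I).
Proof.
apply/asboolP/idP => [[r [a [aI ->]]]|pI]; first by rewrite /= addrC addKr.
by exists p.1, (p.2 - p.1); split=> //; rewrite addrC subrK; case: p {pI}.
Qed.

Fact amalg_dup_subring_closed : subring_closed amalg_dup_pred.
Proof.
split=> [|p q|p q]; rewrite ?amalg_dup_predE; first by rewrite subrr rpred0.
  move=> pI qI; rewrite (_ : _ - _ = (p.2 - p.1 : A^o) - (q.2 - q.1 : A^o)).
    by rewrite rpredD // -scaleN1r rpredZ.
  by rewrite /= !opprB addrACA [RHS]addrACA [- q.2 - _]addrC.
move=> pI qI.
rewrite (_ : _ - _ = p.2 *: (q.2 - q.1 : A^o) + q.1 *: (p.2 - p.1 : A^o)).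
  by rewrite rpredD // rpredZ.
rewrite /GRing.scale /= !mulrBr [q.1 * p.2]mulrC [q.1 * p.1]mulrC.
by rewrite addrA subrK.
Qed.

Definition amalg_dup : Type := {p : A * A | p \in amalg_dup_pred}.

HB.instance Definition _ := SubChoice.on amalg_dup.
HB.instance Definition _ :=
  GRing.SubChoice_isSubComPzRing.Build (A * A)%type
    (fun p => p \in amalg_dup_pred) amalg_dup amalg_dup_subring_closed.

End AmalgamatedDuplication.

(* Main.v *)
From HB Require Import structures.
Require Import Defs.
From mathcomp Require Import all_boot all_order all_algebra.
From mathcomp Require Import perm boolp ring.
Import GRing.Theory.
Local Open Scope ring_scope.

(** Being 1-semiregular is a strong condition.  For a local ring it means that
    the maximal ideal m is principal and m ^ 2 = 0: if A/aA has a periodic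
    resolution of length one and a is a nonzero element of m, then the
    annihilator of a must be aA.  In general the same condition holds up to a
    decomposition of 1 into orthogonal idempotents: every a admits
    1 = e + f + g such that a is invertible on e, vanishes on f, and on g
    generates its own annihilator.  The whole proof goes through this
    elementwise condition, called trichotomy below.

    A 1-semiregular ring is trichotomous ([one_semiregular_trichotomous]).  If
    0 -> A/aA -> P -> A/aA -> 0 is exact, P is generated by two elements u and
    v with explicit relations, and a section of the surjection A^2 -> P turns
    projectivity into polynomial identities between a and a few parameters;
    the three idempotents are polynomials in them.

    A trichotomous ring is 1-semiregular ([trichotomous_one_semiregular]).
    Trichotomy makes any two elements comparable for divisibility on the pieces
    of a decomposition by idempotents, so Gaussian elimination, performed piece
    by piece, diagonalizes every matrix.  Hence a finitely presented module is
    a direct sum of cyclic modules A/aA, and each of these has an explicit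
    periodic resolution, which on the three pieces is 0, the split sequence
    fA -> fA + fA -> fA, and gA/ag -> gA -> gA/ag.

    On the other side, I is pure if and only if every a in I is of the form
    a b with b in I ([pure_ideal_locally_unital],
    [locally_unital_pure_ideal]).

    Elementwise the theorem becomes short.  If the duplication is trichotomous,
    the first projection transports this to A, and the trichotomy of (0, a),
    whose annihilator contains (a, 0), produces b.  If A is trichotomous and I
    is pure, then for (r, s) in the duplication there is an idempotent h in I
    fixing s - r; as s = r away from h, trichotomies of r and s are patched
    along h. *)

Set Implicit Arguments.
Unset Strict Implicit.
Unset Printing Implicit Defensive.

(** * Linear maps, cokernels and projective modules *)

Section LinearMaps.
Variable R : pzRingType.
Implicit Types U V W : lmodType R.

Lemma linear_bundle U V (f : U -> V) :
  linear f -> exists h : {linear U -> V}, h =1 f.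
Proof.
move=> lf; pose F := GRing.isLinear.Build R U V *:%R f lf.
by exists (HB.pack_for (@GRing.Linear.type R U V *:%R) f F).
Qed.

Lemma linear_corestrict U V (S : submodClosed V) (f : {linear U -> V}) :
  (forall x, f x \in S) ->
  exists h : {linear U -> submod S}, forall x, val (h x) = f x.
Proof.
move=> fS.
have [|h hE] := @linear_bundle U (submod S) (fun x => Sub (f x) (fS x)).
  move=> a x y; apply: val_inj.
  by rewrite SubK [LHS]linearP [RHS](linearP (submod_incl S)).
by exists h => x; rewrite hE SubK.
Qed.

Lemma linear_descend U V W (p : {linear U -> V}) (f : {linear U -> W}) :
  surj p -> (forall x, p x = 0 -> f x = 0) ->
  exists h : {linear V -> W}, forall x, h (p x) = f x.
Proof.
move=> surj_p kerp; have [s sK] := choice surj_p.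
have fs x : f (s (p x)) = f x.
  by apply/eqP; rewrite -subr_eq0 -linearB kerp // linearB sK subrr.
have [|h hE] := @linear_bundle _ _ (f \o s).
  move=> a x y /=; rewrite -[f (s x)]fs -linearP.
  by rewrite -[RHS]fs linearP !sK.
by exists h => x; rewrite hE /= fs.
Qed.

End LinearMaps.

Section Cokernel.
Variables (R : pzRingType) (U V : lmodType R) (f : {linear U -> V}).

Definition image_pred : {pred V} := fun y => `[< exists x, f x = y >].

Fact image_submod_closed : submod_closed image_pred.
Proof.
split; first by apply/asboolP; exists 0; rewrite linear0.
move=> a _ _ /asboolP[x <-] /asboolP[y <-]; apply/asboolP.
by exists (a *: x + y); rewrite linearP.
Qed.

HB.instance Definition _ :=
  GRing.isSubmodClosed.Build R V image_pred image_submod_closed.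

Definition image_submod : submodClosed V := image_pred.
Definition cokernel : lmodType R := quotmod image_submod.
Definition cokernel_proj : {linear V -> cokernel} := quotmod_proj image_submod.

Lemma cokernel_proj_exact : exact f cokernel_proj.
Proof.
move=> y; rewrite -(linear0 cokernel_proj).
split=> [/quotmod_piP|[x <-]]; first by rewrite subr0 => /asboolP.
by apply/quotmod_piP; rewrite subr0; apply/asboolP; exists x.
Qed.

Lemma cokernel_proj_surj : surj cokernel_proj.
Proof. by move=> q; exists (repr q); exact: quotmod_piK. Qed.

End Cokernel.

Section Projective.
Variable A : comPzRingType.

Lemma projective_matrix m n : projective 'M[A]_(m, n).
Proof.
move=> U V g f surj_g; have [s sK] := choice surj_g.
pose h (x : 'M[A]_(m, n)) := \sum_i \sum_j x i j *: s (f (delta_mx i j)).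
have [|h' hE] := @linear_bundle _ _ _ h.
  move=> a x y; rewrite /h scaler_sumr -big_split /=; apply: eq_bigr => i _.
  rewrite scaler_sumr -big_split /=; apply: eq_bigr => j _.
  by rewrite !mxE scalerDl scalerA.
exists h' => x; rewrite hE /h [in RHS](matrix_sum_delta x) !linear_sum.
apply: eq_bigr => i _; rewrite !linear_sum.
by apply: eq_bigr => j _; rewrite !linearZ /= sK.
Qed.

Lemma projective_image_idem (F : lmodType A) (p : {linear F -> F}) :
  projective F -> (forall x, p (p x) = p x) ->
  projective (submod (image_submod p)).
Proof.
move=> projF pp U V g f surj_g.
have [|r rE] := linear_corestrict (S := image_submod p) (f := p).
  by move=> x; apply/asboolP; exists x.
have [h hE] := projF U V g (f \o r) surj_g.
exists (h \o submod_incl _) => x; rewrite /= hE /=; congr (f _).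
apply: val_inj; have /asboolP[y yE] := valP x.
by rewrite rE -[RHS]yE -[RHS]pp yE.
Qed.

End Projective.

(** * Trichotomous rings *)

(** On the piece cut out by e the element a is invertible, on that of f it is
    zero, and on that of g its annihilator is the ideal it generates. *)
Definition trichotomy (A : comPzRingType) (a e f g : A) : Prop :=
  [/\ e + f + g = 1, [/\ e * f = 0, e * g = 0 & f * g = 0],
      exists x, e = a * x, a * f = 0
    & a * a * g = 0 /\ forall z, a * z * g = 0 -> exists y, z * g = a * y].

Definition trichotomous (A : comPzRingType) : Prop :=
  forall a : A, exists e f g : A, trichotomy a e f g.

Lemma orthogonal_idem (A : comPzRingType) (u v w : A) :
  u + v + w = 1 -> u * v = 0 -> u * w = 0 -> v * w = 0 ->
  [/\ u * u = u, v * v = v & w * w = w].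
Proof.
move=> uvw uv uw vw; split; rewrite -[RHS]mulr1 -uvw !mulrDr.
- by rewrite uv uw !addr0.
- by rewrite (mulrC v u) uv vw add0r addr0.
- by rewrite (mulrC w u) (mulrC w v) uw vw !add0r.
Qed.

(** * Periodic cyclic modules force the trichotomy *)

(** The first three hypotheses say that the matrix with rows (a, 0), (c, a) is
    von Neumann regular, which is the projectivity of its cokernel P; the last
    one says that A/aA embeds in P.  The first two give a ^ 2 = a ^ 3 s, so
    e = a ^ 2 s ^ 2 is an idempotent on which a is invertible and off which
    a ^ 2 = 0.  Off e the third one makes q = c t idempotent modulo a, with
    a q = a; the idempotent g is its lift 3 q ^ 2 - 2 q ^ 3.  On g the element
    c is invertible modulo a, and the last hypothesis becomes the description
    of the annihilator of a. *)
Lemma trichotomy_of_relations (A : comPzRingType) (a c s t w z : A) :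
  a = a * a * s + a * c * t -> a * a * t = 0 ->
  c = a * c * s + a * a * w + c * c * t + a * c * z ->
  (forall y, a * y = 0 -> exists x, c * y = a * x) ->
  exists e f g : A, trichotomy a e f g.
Proof.
move=> aE a2t cE annE.
have a2E : a * a = a * a * a * s by rewrite {1}aE; ring: a2t.
pose e := a * a * s * s; pose r := 1 - e.
have a2r : a * a * r = 0.
  have -> : a * a * r = a * a - a * a * a * s * (a * s) by rewrite /r /e; ring.
  by rewrite -a2E; apply/eqP; rewrite subr_eq0 {1}a2E; apply/eqP; ring.
have rr : r * r = r.
  have -> : r * r = r - a * a * r * s * s by rewrite /r /e; ring.
  by rewrite a2r !mul0r subr0.
pose q := r * c * t.
have rq : r * q = q by rewrite /q !mulrA rr.
have aq : a * q = a * r.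
  transitivity (r * (a * a * s + a * c * t) - a * a * r * s).
    by rewrite /q; ring.
  by rewrite -aE a2r; ring.
have qq : q * q = q - a * r * (s + z).
  have -> : q * q = q - r * t * (c - c * c * t) by rewrite /q; ring: rr.
  have -> : c - c * c * t = a * c * s + a * a * w + a * c * z.
    by rewrite {1}cE; ring.
  congr (_ - _); transitivity (a * q * (s + z) + a * a * r * (t * w)).
    by rewrite /q; ring.
  by rewrite aq a2r; ring.
pose g := 3 * (q * q) - 2 * (q * q * q).
have gE : g = q - a * r * (s + z) * (1 - 2 * q).
  by rewrite -[a * r * _](subKr q) -qq /g; ring.
have arq : a * r * q = a * r by rewrite -mulrA rq.
have ag : a * g = a * r.
  transitivity (a * q - a * a * r * ((s + z) * (1 - 2 * q))).
    by rewrite gE; ring.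
  by rewrite aq a2r mul0r subr0.
have rg : r * g = g by rewrite gE; ring: rr rq.
have gg : g * g = g.
  transitivity (q * q - a * r * q * (2 * (s + z) * (1 - 2 * q))
    + a * a * r * (r * ((s + z) * (1 - 2 * q)) ^+ 2)).
    by rewrite gE; ring.
  rewrite a2r arq qq gE; transitivity (q - a * r * (s + z) * (1 - 2 * q)
    + (a * r * q - a * r) * (2 * (s + z))); first by ring.
  by rewrite arq subrr mul0r addr0.
have er : e * r = 0.
  transitivity (a * a * r * (s * s)); first by rewrite /e; ring.
  by rewrite a2r mul0r.
have eg : e * g = 0 by rewrite -rg mulrA er mul0r.
exists e, (r - g), g; split.
- by rewrite /r; ring.
- by rewrite mulrBr er eg subrr mulrBl rg gg subrr.
- by exists (a * s * s); rewrite /e; ring.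
- by rewrite mulrBr ag subrr.
split; first by rewrite -mulrA ag mulrA.
move=> y ayg; have ary : a * (r * y) = 0.
  by rewrite mulrA -ag; rewrite -ayg; ring.
have [x cyE] := annE _ ary; exists (t * x).
transitivity (t * (c * (r * y)) - a * (r * y) * ((s + z) * (1 - 2 * q))).
  by rewrite gE /q; ring.
by rewrite ary cyE; ring.
Qed.

(** Let 0 -> M -> P -> M -> 0 be a periodic resolution of M = A/aA, u the image
    of 1 in P, v a lift of 1 and a v = c u.  The pair (u, v) generates P, and
    its relations are the combinations of a u = 0 and a v = c u.  The identities
    express the coordinates of u and v under a section of A^2 -> P. *)
Lemma one_semiregular_relations (A : comPzRingType) (a : A) :
  one_semiregular A -> exists c s t w z : A,
  [/\ a = a * a * s + a * c * t, a * a * t = 0,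
      c = a * c * s + a * a * w + c * c * t + a * c * z &
      forall y, a * y = 0 -> exists x, c * y = a * x].
Proof.
move=> semiA; pose f : {linear 'rV[A]_1 -> 'rV[A]_1} := mulmxr a%:M.
have [|P [i [p [projP [inj_i exact_ip surj_p]]]]] := semiA (cokernel f).
  exists 1, 1, f, (cokernel_proj f).
  by split; [exact: cokernel_proj_exact | exact: cokernel_proj_surj].
pose one : cokernel f := cokernel_proj f 1%:M.
have genM m : exists b, m = b *: one.
  have [x <-] := cokernel_proj_surj m; exists (x 0 0).
  by rewrite -linearZ scale_scalar_mx mulr1 [in LHS](mx11_scalar x).
have annM b : b *: one = 0 <-> exists x, b = a * x.
  rewrite -linearZ; split=> [/cokernel_proj_exact[x]|[x ->]].
    rewrite /= mul_mx_scalar => /matrixP/(_ 0 0); rewrite !mxE mulr1 => <-.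
    by exists (x 0 0).
  apply/cokernel_proj_exact; exists x%:M.
  by rewrite /= mul_mx_scalar !scale_scalar_mx mulr1.
have [v pv] := surj_p one; pose u := i one.
have pi0 m : p (i m) = 0 by apply/exact_ip; exists m.
have [c avE] : exists c, a *: v = c *: u.
  have : p (a *: v) = 0.
    by rewrite linearZ /= pv; apply/annM; exists 1; rewrite mulr1.
  by move=> /exact_ip[m <-]; have [c ->] := genM m; exists c; rewrite linearZ.
have annu b : b *: u = 0 <-> exists x, b = a * x.
  rewrite -annM -linearZ /=; split=> [|->]; last by rewrite linear0.
  by rewrite -(linear0 i) => /inj_i.
have relP x y : x *: u + y *: v = 0 ->
    exists k l, y = a * k /\ x + k * c = a * l.
  move=> xy0; have [k yE] : exists k, y = a * k.
    apply/annM; have := congr1 p xy0.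
    by rewrite linear0 linearD !linearZ /= pi0 scaler0 add0r pv.
  have [l lE] : exists l, x + k * c = a * l.
    apply/annu; rewrite -xy0 yE scalerDl -[(k * c) *: u]scalerA -avE scalerA.
    by rewrite (mulrC k).
  by exists k, l.
have [|uv uvE] := @linear_bundle _ 'rV[A]_2 P
    (fun x => x 0 0 *: u + x 0 1 *: v).
  by move=> b x y; rewrite !mxE !scalerDl scalerDr !scalerA addrACA.
have surj_uv : surj uv.
  move=> y; have [b bE] := genM (p y).
  have : p (y - b *: v) = 0 by rewrite linearB linearZ /= pv bE subrr.
  move=> /exact_ip[m]; have [d ->] := genM m; rewrite linearZ /= => dE.
  exists (\row_j if j == 0 then d else b).
  by rewrite uvE !mxE /= dE subrK.
have [h hK] := projP _ _ uv idfun surj_uv.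
have hE x : h x 0 0 *: u + h x 0 1 *: v = x by rewrite -uvE hK.
have [k [l [h1u h0u]]] :
    exists k l, h u 0 1 = a * k /\ h u 0 0 - 1 + k * c = a * l.
  by apply: relP; rewrite scalerBl scale1r addrAC hE subrr.
have [k' [l' [h1v h0v]]] :
    exists k l, h v 0 1 - 1 = a * k /\ h v 0 0 + k * c = a * l.
  by apply: relP; rewrite scalerBl scale1r addrA hE subrr.
have au0 : a *: u = 0 by apply/annu; exists 1; rewrite mulr1.
have hu j : a * h u 0 j = 0.
  by have := congr1 (fun x => h x 0 j) au0; rewrite linearZ linear0 !mxE.
have hv j : a * h v 0 j = c * h u 0 j.
  by have := congr1 (fun x => h x 0 j) avE; rewrite !linearZ !mxE.
have {}h0u : h u 0 0 = 1 - k * c + a * l by rewrite -h0u; ring.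
have {}h0v : h v 0 0 = a * l' - k' * c by rewrite -h0v; ring.
exists c, (- l), k, l', (- k'); split.
- have := hu 0; rewrite h0u => hu0.
  by apply/eqP; rewrite -subr_eq0 -hu0; apply/eqP; ring.
- by rewrite -mulrA -h1u hu.
- have := hv 0; rewrite h0u h0v => /eqP; rewrite -subr_eq0 => /eqP hv0.
  by apply/eqP; rewrite -subr_eq0 -oppr_eq0 -hv0; apply/eqP; ring.
move=> y ay0; apply/annu.
by rewrite mulrC -scalerA -avE scalerA mulrC ay0 scale0r.
Qed.

Lemma one_semiregular_trichotomous (A : comPzRingType) :
  one_semiregular A -> trichotomous A.
Proof.
move=> semiA a.
have [c [s [t [w [z [H1 H2 H3 H4]]]]]] := one_semiregular_relations a semiA.
exact: trichotomy_of_relations H1 H2 H3 H4.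
Qed.

(** * Divisibility over a trichotomous ring *)

Section Gluing.
Variables (A : comPzRingType) (Q : A -> Prop).

(** Q k is meant to say that some construction succeeds on the piece of the
    spectrum cut out by k.  Working with multiples k l of k, rather than with
    localizations, keeps all the pieces inside the same ring. *)
Definition glues : Prop :=
  forall k e : A, e * e = e -> Q (k * e) -> Q (k * (1 - e)) -> Q k.

Hypothesis glueQ : glues.

Lemma glue_three (k e f g : A) :
  e + f + g = 1 -> e * f = 0 -> e * g = 0 -> f * g = 0 ->
  Q (k * e) -> Q (k * f) -> Q (k * g) -> Q k.
Proof.
move=> efg1 ef eg fg Qe Qf Qg.
have [ee ff _] := orthogonal_idem efg1 ef eg fg.
have e1 : 1 - e = f + g by rewrite -efg1; ring.
have fgf : (f + g) * f = f by rewrite mulrDl ff (mulrC g) fg addr0.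
apply: (glueQ ee Qe); apply: (glueQ ff); rewrite -mulrA e1.
  by rewrite fgf.
by rewrite mulrBr mulr1 fgf addrAC subrr add0r.
Qed.

Hypothesis triA : trichotomous A.

(** Comparability is clear where a or b is invertible or zero.  On the
    remaining piece a ^ 2 = b ^ 2 = 0 and the trichotomy of a b decides: a b is
    not invertible there; where a b = 0, b annihilates a and is a multiple of
    it; where a b generates its annihilator, which contains a, b divides a. *)
Lemma glue_comparable (a b k : A) :
  (forall l z, k * l * b = k * l * (a * z) -> Q (k * l)) ->
  (forall l z, k * l * a = k * l * (b * z) -> Q (k * l)) ->
  Q k.
Proof.
move=> Qab Qba.
have [e [f [g [efg1 [ef eg fg] [x eE] af [aag annG]]]]] := triA a.
have [e' [f' [g' [efg1' [ef' eg' fg'] [x' eE'] bf' [bbg' _]]]]] := triA b.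
have [e2 [f2 [g2 [efg2 [ef2 eg2 fg2] [x2 eE2] abf2 [_ ann2]]]]] := triA (a * b).
have [ee _ gg] := orthogonal_idem efg1 ef eg fg.
have [ee' _ _] := orthogonal_idem efg1' ef' eg' fg'.
have [_ ff2 gg2] := orthogonal_idem efg2 ef2 eg2 fg2.
apply: (glue_three efg1 ef eg fg).
- by apply: (Qab e (x * b)); rewrite (mulrA a) -eE; ring: ee.
- by apply: (Qba f 0); rewrite !mulr0 -mulrA (mulrC f) af mulr0.
apply: (glue_three efg1' ef' eg' fg'); rewrite -mulrA.
- by apply: (Qba (g * e') (x' * a)); rewrite (mulrA b) -eE'; ring: ee'.
- by apply: (Qab (g * f') 0); rewrite !mulr0 -!mulrA (mulrC f') bf' !mulr0.
apply: (glue_three efg2 ef2 eg2 fg2); rewrite -mulrA.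
- by apply: (Qab (g * g' * e2) 0); rewrite !mulr0 eE2; ring: bbg'.
- have [y yE] : exists y, b * f2 * g = a * y by apply: annG; ring: abf2.
  by apply: (Qab (g * g' * f2) y); rewrite -yE; ring: gg ff2.
have [y yE] : exists y, a * g * g2 = a * b * y by apply: ann2; ring: aag.
apply: (Qba (g * g' * g2) (a * y)).
have -> : b * (a * y) = a * g * g2 by rewrite yE; ring.
by ring: gg gg2.
Qed.

Lemma glue_least (T : eqType) (v : T -> A) (s : seq T) (i0 : T) (k : A) :
  (forall l i, (forall j, j \in i0 :: s ->
      exists z, k * l * v j = k * l * (v i * z)) -> Q (k * l)) ->
  Q k.
Proof.
elim: s i0 k => [|i1 s IH] i0 k Qk.
  rewrite -[k]mulr1; apply: (Qk 1 i0) => j /[!inE] /eqP ->.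
  by exists 1; rewrite !mulr1.
apply: (IH i1) => l i ile; apply: (@glue_comparable (v i0) (v i)) => l' z zE.
  rewrite -mulrA; apply: (Qk (l * l') i0) => j; rewrite inE => /orP[/eqP->|].
    by exists 1; rewrite !mulr1.
  move=> /ile[y yE]; exists (z * y).
  transitivity (k * l * v j * l'); first by ring.
  rewrite yE; transitivity (k * l * l' * v i * y); first by ring.
  by rewrite zE; ring.
rewrite -mulrA; apply: (Qk (l * l') i) => j; rewrite inE => /orP[/eqP->|].
  by exists z; rewrite (mulrA k).
by move=> /ile[y yE]; exists y; rewrite (mulrA k) mulrAC yE; ring.
Qed.

End Gluing.

(** * Diagonalization of matrices *)

(** After the change of coordinates V the matrices X and diag_mx d have, on the
    piece k, the same row space.  Asking for U and U' instead of an invertible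
    row transformation makes d a full vector of n entries, whatever m is: when
    n > m the missing rows are accounted for by zeros in d. *)
Definition diagonalizable_at (A : comPzRingType) m n
    (X : 'M[A]_(m, n)) (k : A) : Prop :=
  exists (V V' : 'M[A]_n) (U : 'M[A]_(m, n)) (U' : 'M[A]_(n, m))
    (d : 'rV[A]_n),
    [/\ V *m V' = 1%:M, V' *m V = 1%:M,
        k *: (X *m V) = k *: (U *m diag_mx d)
      & k *: diag_mx d = k *: (U' *m X *m V)].

Section Diagonalization.
Variable A : comPzRingType.

(** Solutions on the pieces e and 1 - e combine entrywise, because
    M, N |-> e M + (1 - e) N is compatible with all matrix operations. *)
Lemma diagonalizable_glues m n (X : 'M[A]_(m, n)) :
  glues (diagonalizable_at X).
Proof.
move=> k e ee [V1 [V1' [U1 [U1' [d1 [VV1 VV1' XV1 dE1]]]]]].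
move=> [V2 [V2' [U2 [U2' [d2 [VV2 VV2' XV2 dE2]]]]]].
pose e' := 1 - e.
have ee' : e * e' = 0 by rewrite mulrBr mulr1 ee subrr.
have e'e : e' * e = 0 by rewrite mulrC.
have e'e' : e' * e' = e' by rewrite {1}/e' mulrBl mul1r ee' subr0.
have ee1 : e + e' = 1 by rewrite addrC subrK.
pose mix p q (M N : 'M[A]_(p, q)) := e *: M + e' *: N.
have mixM p q r (M1 N1 : 'M[A]_(p, q)) (M2 N2 : 'M[A]_(q, r)) :
    mix _ _ M1 N1 *m mix _ _ M2 N2 = mix _ _ (M1 *m M2) (N1 *m N2).
  rewrite /mix mulmxDl !mulmxDr -!scalemxAl -!scalemxAr !scalerA.
  by rewrite ee ee' e'e e'e' !scale0r addr0 add0r.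
have mix_id p q (M : 'M[A]_(p, q)) : mix _ _ M M = M.
  by rewrite /mix -scalerDl ee1 scale1r.
have mix_diag (c d : 'rV[A]_n) :
    diag_mx (mix _ _ c d) = mix _ _ (diag_mx c) (diag_mx d).
  by rewrite /mix linearD !linearZ.
exists (mix _ _ V1 V2), (mix _ _ V1' V2'), (mix _ _ U1 U2), (mix _ _ U1' U2').
exists (mix _ _ d1 d2); split; first by rewrite mixM VV1 VV2 mix_id.
- by rewrite mixM VV1' VV2' mix_id.
- rewrite -[in LHS](mix_id _ _ X) mix_diag !mixM /mix !scalerDr !scalerA.
  by rewrite XV1 XV2.
- rewrite -[in RHS](mix_id _ _ X) mix_diag !mixM /mix !scalerDr !scalerA.
  by rewrite dE1 dE2.
Qed.

Lemma diagonalizable_equiv m n (X : 'M[A]_(m, n))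
    (P P' : 'M[A]_m) (Q Q' : 'M[A]_n) k :
  P' *m P = 1%:M -> Q *m Q' = 1%:M -> Q' *m Q = 1%:M ->
  diagonalizable_at (P *m X *m Q) k -> diagonalizable_at X k.
Proof.
move=> P'P QQ' Q'Q [V [V' [U [U' [d [VV' V'V XV dE]]]]]].
exists (Q *m V), (V' *m Q'), (P' *m U), (U' *m P), d; split.
- by rewrite mulmxA -(mulmxA Q) VV' mulmx1.
- by rewrite mulmxA -(mulmxA V') Q'Q mulmx1.
- rewrite -(mulmxA P') [RHS]scalemxAr -XV -scalemxAr !mulmxA.
  by rewrite P'P mul1mx.
- by rewrite dE !mulmxA.
Qed.

(** One step of Gaussian elimination, with a pivot p that divides on the piece
    k the rest r = p r' of its row and the rest c = c' p of its column. *)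
Lemma diagonalizable_block m n (p : 'M[A]_1) (r : 'rV[A]_n) (c : 'cV[A]_m)
    (Y : 'M[A]_(m, n)) r' c' k :
  k *: r = k *: (p *m r') -> k *: c = k *: (c' *m p) ->
  diagonalizable_at (Y - c *m r') k -> diagonalizable_at (block_mx p r c Y) k.
Proof.
move=> rE cE [V [V' [U [U' [d [VV' V'V YV dE]]]]]].
have clear_row : k *: (r - p *m r') = 0 by rewrite scalerBr rE subrr.
have clear_col : k *: (c - c' *m p) = 0 by rewrite scalerBr cE subrr.
exists (block_mx 1%:M (- r' *m V) 0 V), (block_mx 1%:M r' 0 V').
exists (block_mx 1%:M 0 c' U), (block_mx 1%:M 0 (- U' *m c') U'), (row_mx p d).
have XV : block_mx p r c Y *m block_mx 1%:M (- r' *m V) 0 V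
    = block_mx p ((r - p *m r') *m V) c ((Y - c *m r') *m V).
  rewrite mulmx_block !mulmx1 !mulmx0 !addr0 !mulmxBl.
  by rewrite mulNmx !mulmxN !mulmxA ![- _ + _]addrC.
have diag1 : diag_mx p = p.
  by rewrite [p]mx11_scalar; apply/matrixP=> i j; rewrite !mxE !ord1.
split.
- rewrite mulmx_block !mul1mx !mulmx1 !mul0mx !mulmx0 !addr0 add0r.
  by rewrite -mulmxA VV' mulmx1 subrr -scalar_mx_block.
- rewrite mulmx_block !mul1mx !mulmx1 !mul0mx !mulmx0 !addr0 !add0r.
  by rewrite V'V mulNmx addNr -scalar_mx_block.
- rewrite XV diag_mx_row diag1 mulmx_block !mul1mx !mul0mx !mulmx0.
  rewrite !addr0 !add0r !scale_block_mx -YV -cE.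
  by rewrite scalemxAl clear_row mul0mx scaler0.
- rewrite -mulmxA XV diag_mx_row diag1 mulmx_block !mul1mx !mul0mx !addr0.
  rewrite !scale_block_mx; congr block_mx.
  + by rewrite scalemxAl clear_row mul0mx scaler0.
  + rewrite scaler0 mulNmx mulNmx -mulmxA addrC -mulmxBr scalemxAr clear_col.
    by rewrite mulmx0.
  + rewrite scalerDr [X in X + _]scalemxAr [k *: (_ *m V)]scalemxAl clear_row.
    by rewrite mul0mx mulmx0 add0r mulmxA.
Qed.

Lemma tperm_mxK n (i j : 'I_n) :
  tperm_mx i j *m tperm_mx i j = 1%:M :> 'M[A]_n.
Proof. by rewrite -perm_mxM tperm2 perm_mx1. Qed.

Lemma trichotomous_diagonalizable : trichotomous A ->
  forall m n (X : 'M[A]_(m, n)) k, diagonalizable_at X k.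
Proof.
move=> triA; elim=> [|m IHm] [|n] X k.
- exists 1%:M, 1%:M, 0, 0, 0.
  by split; rewrite ?mulmx1 //; congr (_ *: _); apply/matrixP=> -[].
- exists 1%:M, 1%:M, 0, 0, 0; split; rewrite ?mulmx1 //; congr (_ *: _).
    by apply/matrixP=> -[].
  by rewrite !mul0mx linear0.
- exists 1%:M, 1%:M, 0, 0, 0.
  by split; rewrite ?mulmx1 //; congr (_ *: _); apply/matrixP=> i -[].
(* On each piece k l some entry (i, j) divides all the others; it is moved to
   the upper left corner. *)
pose v (t : 'I_m.+1 * 'I_n.+1) := X t.1 t.2.
apply: (glue_least (@diagonalizable_glues _ _ X) triA (v := v)
  (s := enum predT) (i0 := (0, 0))) => l [i j] ijle.
set k' := k * l in ijle *.
apply: (diagonalizable_equiv (tperm_mxK i 0) (tperm_mxK j 0) (tperm_mxK j 0)).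
rewrite -xcolE -xrowE; set X' := xcol _ _ _.
have dvdX' a b : exists z, k' * X' a b = k' * (X' 0 0 * z).
  rewrite !mxE !tpermR.
  apply: (ijle (tperm i 0 a, tperm j 0 b)).
  by rewrite inE mem_enum orbT.
have [r' r'E] := fin_all_exists (fun b => dvdX' 0 b).
have [c' c'E] := fin_all_exists (fun a => dvdX' a 0).
clearbody X'.
have lshift0 p : lshift p (0 : 'I_1) = (0 : 'I_p.+1) by apply: val_inj.
rewrite -[X'](@submxK _ 1 m 1 n).
apply: (@diagonalizable_block _ _ _ _ _ _
  (\row_b r' (rshift 1 b)) (\col_a c' (rshift 1 a))).
- apply/matrixP=> a b; rewrite !mxE big_ord1 !mxE !ord1 !lshift0.
  exact: r'E.
- apply/matrixP=> a b; rewrite !mxE big_ord1 !mxE !ord1 !lshift0.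
  by rewrite (mulrC (c' _)); exact: c'E.
exact: IHm.
Qed.

End Diagonalization.

(** * Periodic resolutions over a trichotomous ring *)

(** M is the direct sum of the A/d_j A.  With trichotomies (e_j, f_j, g_j) of
    the d_j, the module P consists of the pairs of vectors (x, y) with
    x = (f + g) x and y = f y.  The maps are z |-> ((g d + f) z, 0) from M to P
    and (x, y) |-> g x + y from P to M: on f this is the inclusion of the first
    summand of fA + fA and the projection on the second, and on g it is the
    multiplication by d and the projection of gA on gA/dg. *)
Lemma one_periodic_diagonal (A : comPzRingType) n (d : 'rV[A]_n)
    (M : lmodType A) (q : {linear 'rV[A]_n -> M}) :
  trichotomous A -> surj q ->
  (forall z, q z = 0 <-> exists w : 'rV_n, forall j, z 0 j = d 0 j * w 0 j) ->
  one_periodic M.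
Proof.
move=> triA surj_q kerq.
have [e eP] := choice (fun j => triA (d 0 j)).
have [f {}eP] := choice eP; have [g {}eP] := choice eP.
have ef j : e j * f j = 0 by have [_ []] := eP j.
have eg j : e j * g j = 0 by have [_ []] := eP j.
have fg j : f j * g j = 0 by have [_ []] := eP j.
have efg j : e j + f j + g j = 1 by have [] := eP j.
have ff j : f j * f j = f j.
  by have [] := orthogonal_idem (efg j) (ef j) (eg j) (fg j).
have gg j : g j * g j = g j.
  by have [] := orthogonal_idem (efg j) (ef j) (eg j) (fg j).
have df j : d 0 j * f j = 0 by have [] := eP j.
have ddg j : d 0 j * d 0 j * g j = 0 by have [_ _ _ _ []] := eP j.
have ord2 (i : 'I_2) : i = 0 \/ i = 1.
  by case: i => [[|[|//]] lti]; [left | right]; apply: val_inj.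
(* P is the image of an idempotent endomorphism of a free module. *)
pose proj (x : 'M[A]_(2, n)) : 'M[A]_(2, n) :=
  \matrix_(i, j) ((if i == 0 then f j + g j else f j) * x i j).
have [|pr prE] := @linear_bundle _ _ _ proj.
  by move=> a x y; apply/matrixP=> i j; rewrite !mxE; ring.
have fixP x : x \in image_submod pr <->
    forall j, (f j + g j) * x 0 j = x 0 j /\ f j * x 1 j = x 1 j.
  split=> [/asboolP[y <-] j|xE].
    by rewrite prE !mxE /=; split; ring: (ff j) (gg j) (fg j).
  apply/asboolP; exists x; rewrite prE; apply/matrixP=> i j; rewrite mxE.
  by have [x0 x1] := xE j; have [->|->] := ord2 i.
have prpr x : pr (pr x) = pr x.
  apply/matrixP=> i j; rewrite !prE !mxE.
  by case: ifP => _; ring: (ff j) (gg j) (fg j).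
pose P := submod (image_submod pr).
have projP : projective P.
  exact: projective_image_idem (@projective_matrix _ _ _) prpr.
pose emb (z : 'rV[A]_n) : 'M[A]_(2, n) :=
  \matrix_(i, j) (if i == 0 then (g j * d 0 j + f j) * z 0 j else 0).
have [|emb1 emb1E] := @linear_bundle _ _ _ emb.
  by move=> a x y; apply/matrixP=> i j; rewrite !mxE; case: ifP => _; ring.
have [|emb2 emb2E] := linear_corestrict (S := image_submod pr) (f := emb1).
  move=> z; apply/fixP => j; rewrite emb1E !mxE /= mulr0; split=> //.
  by ring: (ff j) (gg j) (fg j).
have embE0 z j : val (emb2 z) 0 j = (g j * d 0 j + f j) * z 0 j.
  by rewrite emb2E emb1E mxE.
have embE1 z j : val (emb2 z) 1 j = 0 by rewrite emb2E emb1E mxE.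
have emb0 z : q z = 0 <-> emb2 z = 0.
  rewrite kerq; split=> [[w wE]|z0].
    apply/val_inj/matrixP=> i j; rewrite [RHS]mxE.
    have [->|->] := ord2 i; rewrite ?embE1 // embE0 wE.
    transitivity (d 0 j * d 0 j * g j * w 0 j + d 0 j * f j * w 0 j).
      by ring.
    by rewrite ddg df !mul0r addr0.
  suff wP j : exists w, z 0 j = d 0 j * w.
    have [w wE] := choice wP.
    by exists (\row_j w j) => j; rewrite mxE; exact: wE.
  have [_ _ [x xE] _ [_ ann]] := eP j.
  have zj0 : (g j * d 0 j + f j) * z 0 j = 0 by rewrite -embE0 z0 mxE.
  have fz0 : f j * z 0 j = 0.
    transitivity (f j * ((g j * d 0 j + f j) * z 0 j)).
      by ring: (ff j) (fg j).
    by rewrite zj0 mulr0.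
  have [|y yE] := ann (z 0 j); first by rewrite -[RHS]zj0; ring: fz0.
  exists (x * z 0 j + y); rewrite mulrDr mulrA -xE -yE -[LHS]mul1r -(efg j).
  by ring: fz0.
have [|i iE] := @linear_descend _ _ _ _ q emb2 surj_q.
  by move=> z /emb0.
pose cov (x : 'M[A]_(2, n)) : 'rV[A]_n := \row_j (g j * x 0 j + x 1 j).
have [|cov1 cov1E] := @linear_bundle _ _ _ cov.
  by move=> a x y; apply/rowP=> j; rewrite !mxE; ring.
have covE x j : cov1 x 0 j = g j * x 0 j + x 1 j by rewrite cov1E mxE.
pose p : {linear P -> M} := q \o (cov1 \o submod_incl _).
exists P, i, p; split=> //; split.
- move=> m1 m2; have [z1 <-] := surj_q m1; have [z2 <-] := surj_q m2.
  rewrite !iE => /eqP; rewrite -subr_eq0 -linearB => /eqP/emb0.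
  by rewrite linearB => /eqP; rewrite subr_eq0 => /eqP.
- move=> x; rewrite /p /= kerq; split=> [[w wE]|[m <-]]; last first.
    have [z <-] := surj_q m; exists (\row_j (g j * z 0 j)) => j.
    rewrite iE covE embE0 embE1 mxE.
    by ring: (gg j) (fg j).
  have /fixP xP := valP x.
  (* If g x + y = d w, then y = 0 and x = f x + d g w comes from f x + g w. *)
  exists (q (\row_j (f j * val x 0 j + g j * w 0 j))); rewrite iE.
  apply/val_inj/matrixP=> k j; have [x0E x1E] := xP j.
  have := wE j; rewrite covE => {}wE.
  have x1 : val x 1 j = 0.
    rewrite -x1E; transitivity
      (f j * (g j * val x 0 j + val x 1 j) - f j * g j * val x 0 j).
      by ring.
    by rewrite wE; ring: (df j) (fg j).
  have [->|->] := ord2 k; rewrite ?embE1 // embE0 mxE -[RHS]x0E.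
  have gx : g j * val x 0 j = d 0 j * w 0 j by rewrite -wE x1 addr0.
  transitivity (g j * (d 0 j * w 0 j) + f j * val x 0 j).
    by ring: (gg j) (ff j) (fg j) (df j).
  by rewrite -gx; ring: (gg j).
- move=> m; have [z <-] := surj_q m.
  (* The class of e z is zero, so that of z is the image of (g z, f z). *)
  pose x : 'M[A]_(2, n) :=
    \matrix_(k, j) ((if k == 0 then g j else f j) * z 0 j).
  have xP : x \in image_submod pr.
    by apply/fixP => j; rewrite !mxE /=; split; ring: (gg j) (ff j) (fg j).
  exists (Sub x xP); rewrite /p /=; apply/eqP.
  rewrite -subr_eq0 -linearB; apply/eqP/kerq.
  have [y yE] := choice (fun j => let: And5 _ _ h _ _ := eP j in h).
  exists (\row_j (- y j * z 0 j)) => j; rewrite !mxE cov1E !mxE /=.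
  transitivity (- e j * z 0 j); last by rewrite yE; ring.
  transitivity ((g j + f j - 1) * z 0 j); first by ring: (gg j).
  by rewrite -(efg j); ring.
Qed.

Lemma trichotomous_one_semiregular (A : comPzRingType) :
  trichotomous A -> one_semiregular A.
Proof.
move=> triA M [m [n [f [g [exact_fg surj_g]]]]].
have [V [V' [U [U' [d [VV' V'V XV dE]]]]]] :=
  trichotomous_diagonalizable triA (lin1_mx f) 1.
rewrite !scale1r in XV dE.
apply: (@one_periodic_diagonal _ _ d M (g \o mulmxr V')) => //.
  move=> y; have [x <-] := surj_g y; exists (x *m V) => /=.
  by rewrite -mulmxA VV' mulmx1.
move=> z /=; rewrite exact_fg; split.
- move=> [y yE]; exists (y *m U) => j.
  have -> : z = y *m lin1_mx f *m V.
    by rewrite mul_rV_lin1 yE -mulmxA V'V mulmx1.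
  by rewrite -mulmxA XV mulmxA mul_mx_diag mxE mulrC.
move=> [w wE]; exists (w *m U').
have -> : z = w *m diag_mx d.
  by apply/rowP=> j; rewrite mul_mx_diag mxE wE mulrC.
by rewrite dE -mul_rV_lin1 -!mulmxA VV' mulmx1.
Qed.

(** * Right exactness of the tensor product *)

Section TensorExact.
Variables (A : comPzRingType) (V : lmodType A) (S : submodClosed V).
Variable M : lmodType A.

Lemma tensZ (U N : lmodType A) a (u : U) (n : N) :
  tens (a *: u) n = tens u (a *: n).
Proof. exact/tensor_piP/tensor_Z. Qed.

Lemma tens0 (U N : lmodType A) (n : N) : tens (0 : U) n = 0.
Proof. exact/tensor_piP/tensor_0l. Qed.

Lemma tensr0 (U N : lmodType A) (u : U) : tens u (0 : N) = 0.
Proof. by rewrite -(scale0r (0 : N)) -tensZ scale0r tens0. Qed.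

Lemma tensor_map_sum (T : Type) (U W : lmodType A) (f : {linear U -> W})
    (s : seq T) (u : T -> U) (n : T -> M) :
  tensor_map f M (\sum_(p <- s) tens (u p) (n p))
    = \sum_(p <- s) tens (f (u p)) (n p).
Proof. by rewrite linear_sum; apply: eq_bigr => p _; exact: tensor_mapE. Qed.

(** The bilinear map sending the class of v and m to the class of the tensor of
    v and m inverts the canonical map from the cokernel of the first arrow to
    the tensor product of V/S and M. *)
Lemma tensor_right_exact :
  exact (tensor_map (submod_incl S) M) (tensor_map (quotmod_proj S) M).
Proof.
have [_ exact_S surj_S] := submod_quotmod_exact S.
pose C := cokernel (tensor_map (submod_incl S) M).
pose c : {linear tensor V M -> C} := cokernel_proj _.
have lift_at m : exists h : {linear quotmod S -> C},
    forall v, h (quotmod_proj S v) = c (tens v m).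
  have [|f fE] := @linear_bundle _ _ _ (fun v => c (tens v m)).
    by move=> a v v'; rewrite tens_linearl linearP.
  have [|h hE] := @linear_descend _ _ _ _ (quotmod_proj S) f surj_S.
    move=> v /exact_S[x <-]; rewrite fE; apply/cokernel_proj_exact.
    by exists (tens x m); rewrite tensor_mapE.
  by exists h => v; rewrite hE fE.
have [h hE] := choice lift_at.
have hl m : linear (fun q => h m q) by move=> a q q'; rewrite linearP.
have hr q : linear (fun m => h m q).
  move=> a m m'; have [v <-] := surj_S q.
  by rewrite !hE tens_linearr linearP.
pose k : {linear tensor (quotmod S) M -> C} := tensor_lift hl hr.
have kE y : k (tensor_map (quotmod_proj S) M y) = c y.
  have [s ->] := tensor_sumP y; rewrite tensor_map_sum !linear_sum.
  by apply: eq_bigr => p _; rewrite [LHS]tensor_liftE hE.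
move=> y; split=> [y0|[x <-]].
  by apply/cokernel_proj_exact; rewrite -/c -kE y0 linear0.
have [s ->] := tensor_sumP x; rewrite !tensor_map_sum big1 // => p _.
have -> : quotmod_proj S (submod_incl S p.1) = 0 by apply/exact_S; exists p.1.
exact: tens0.
Qed.

Lemma tensor_map_surj (W : lmodType A) (f : {linear V -> W}) :
  surj f -> surj (tensor_map f M).
Proof.
move=> /choice[s sK] y; have [t ->] := tensor_sumP y.
exists (\sum_(p <- t) tens (s p.1) p.2).
by rewrite tensor_map_sum; apply: eq_bigr => p _; rewrite sK.
Qed.

End TensorExact.

(** * Elementwise characterization of pure ideals *)

Section PureIdeal.
Variables (A : comPzRingType) (I : submodClosed A^o).

Lemma ideal_mulr (a b : A) : (a : A^o) \in I -> (a * b : A^o) \in I.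
Proof. by move=> aI; rewrite mulrC; apply: rpredZ. Qed.

Lemma ideal_add (a b : A) :
  (a : A^o) \in I -> (b : A^o) \in I -> (a + b : A^o) \in I.
Proof. exact: rpredD. Qed.

Lemma ideal_sub (a b : A) :
  (a : A^o) \in I -> (b : A^o) \in I -> (a - b : A^o) \in I.
Proof.
by move=> aI bI; rewrite -mulN1r; apply: rpredD => //; apply: rpredZ.
Qed.

Definition locally_unital : Prop :=
  forall a : A, (a : A^o) \in I -> exists2 b : A, (b : A^o) \in I & a = a * b.

(** Purity is tested on M = A/aA.  The tensor of a and 1 dies in the tensor
    product of A and M, hence is already zero in that of I and M; its image
    under the multiplication to A/aI says that a lies in aI. *)
Lemma pure_ideal_locally_unital : pure_ideal I -> locally_unital.
Proof.
move=> pureI a aI.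
have [|mula mulaE] := @linear_bundle _ A^o A^o (fun x => a * x).
  by move=> b x y; rewrite mulrDr; congr (_ + _); rewrite mulrCA.
pose M := cokernel mula; pose pM : {linear A^o -> M} := cokernel_proj mula.
pose aI_incl : {linear submod I -> A^o} := mula \o submod_incl I.
pose W := cokernel aI_incl.
pose pW : {linear A^o -> W} := cokernel_proj aI_incl.
have lift_at (i : submod I) : exists h : {linear M -> W},
    forall x : A, h (pM x) = pW (val i * x).
  have [|f fE] := @linear_bundle _ A^o W (fun x => pW (val i * x)).
    move=> b x y; rewrite -linearP; congr (pW _).
    by rewrite mulrDr; congr (_ + _); rewrite mulrCA.
  have [|h hE] :=
      @linear_descend _ _ _ _ pM f (@cokernel_proj_surj _ _ _ mula).
    move=> x /cokernel_proj_exact[y]; rewrite mulaE fE => <-.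
    apply/cokernel_proj_exact; exists (y *: i).
    by rewrite [LHS]mulaE linearZ; exact: etrans (mulrA _ _ _) (mulrC _ _).
  by exists h => x; rewrite hE fE.
have [h hE] := choice lift_at.
have hl m : linear (fun i => h i m).
  move=> b i j; have [x <-] := cokernel_proj_surj m; rewrite !hE -linearP.
  congr (pW _); rewrite (linearP (submod_incl I)) mulrDl; congr (_ + _).
  exact/esym/mulrA.
have hr i : linear (h i : M -> W) by move=> b m m'; rewrite linearP.
pose k : {linear tensor (submod I) M -> W} := tensor_lift hl hr.
pose a' : submod I := Sub a aI.
have t0 : tens a' (pM 1) = 0.
  have [inj _ _] := pureI M; apply: inj; rewrite linear0 tensor_mapE /=.
  have -> : (a : A^o) = a *: (1 : A^o) by rewrite /GRing.scale /= mulr1.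
  rewrite tensZ -linearZ.
  have -> : pM (a *: (1 : A^o)) = 0.
    by apply/cokernel_proj_exact; exists 1; rewrite mulaE.
  exact: tensr0.
have := congr1 k t0; rewrite linear0 [LHS]tensor_liftE hE.
move=> /cokernel_proj_exact[i]; rewrite /= mulaE mulr1 => aE.
by exists (val i); [exact: valP | rewrite aE].
Qed.

Lemma locally_unital_seq (s : seq (submod I)) : locally_unital ->
  exists2 b : A, (b : A^o) \in I & forall i, i \in s -> val i = val i * b.
Proof.
move=> unitI; elim: s => [|i s [b bI bE]].
  by exists 0 => //; exact: (rpred0 I).
have [c cI cE] := unitI (val i) (valP i).
(* 1 - (b + c - b c) = (1 - b) (1 - c). *)
exists (b + c - b * c).
  by apply: ideal_sub; [exact: ideal_add | exact: ideal_mulr].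
move=> j; rewrite inE => /predU1P[->|/bE jE].
  transitivity (val i * c + val i * b - val i * c * b); last by ring.
  by rewrite -cE addrK.
transitivity (val j * b + val j * c - val j * b * c); last by ring.
by rewrite -jE addrK.
Qed.

(** A tensor over I involves finitely many elements of I, and multiplication by
    a common unit b for them, as a map from A to I, undoes the inclusion on
    that tensor. *)
Lemma locally_unital_pure_ideal : locally_unital -> pure_ideal I.
Proof.
move=> unitI M; have [_ _ surj_I] := submod_quotmod_exact I.
split; [|exact: tensor_right_exact|exact: tensor_map_surj].
move=> x y /eqP; rewrite -subr_eq0 -linearB => /eqP xy0.
apply/eqP; rewrite -subr_eq0; move: (x - y) xy0 => {x y}z z0.
have [s zE] := tensor_sumP z.
have [b bI bE] := locally_unital_seq (unzip1 s) unitI.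
have [|mulb mulbE] := @linear_bundle _ A^o A^o (fun x => x * b).
  by move=> c x y; rewrite mulrDl; congr (_ + _); apply/esym/mulrA.
have [|rho rhoE] := linear_corestrict (S := I) (f := mulb).
  by move=> x; rewrite mulbE mulrC ideal_mulr.
rewrite -(linear0 (tensor_map rho M)) -z0 zE.
rewrite (tensor_map_sum (submod_incl I)) (tensor_map_sum rho).
apply/eqP; apply: eq_big_seq => p ps; congr tens.
by apply: val_inj; rewrite rhoE mulbE; apply: bE; apply: map_f.
Qed.

End PureIdeal.

(** * The trichotomy in the amalgamated duplication *)

Section Duplication.
Variables (A : comPzRingType) (I : submodClosed A^o).
Local Notation R := (amalg_dup I).

Definition fst_coord (z : R) : A := (val z).1.
Definition snd_coord (z : R) : A := (val z).2.

Lemma amalg_dup_inj (z z' : R) :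
  fst_coord z = fst_coord z' -> snd_coord z = snd_coord z' -> z = z'.
Proof.
move=> E1 E2; apply: val_inj.
rewrite [val z]surjective_pairing [val z']surjective_pairing.
by congr (_, _).
Qed.

Lemma amalg_dup_coordP (x y : A) : (y - x : A^o) \in I ->
  exists z : R, fst_coord z = x /\ snd_coord z = y.
Proof.
move=> xyI; have zP : (x, y) \in amalg_dup_pred I by rewrite amalg_dup_predE.
by exists (Sub (x, y) zP).
Qed.

Lemma amalg_dup_diag (x : A) :
  exists z : R, fst_coord z = x /\ snd_coord z = x.
Proof. by apply: amalg_dup_coordP; rewrite subrr; exact: (rpred0 I). Qed.

Lemma amalg_dup_sub (z : R) : (snd_coord z - fst_coord z : A^o) \in I.
Proof. by have := valP z; rewrite amalg_dup_predE. Qed.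

Lemma fst_coordM (z z' : R) : fst_coord (z * z') = fst_coord z * fst_coord z'.
Proof. by []. Qed.

Lemma snd_coordM (z z' : R) : snd_coord (z * z') = snd_coord z * snd_coord z'.
Proof. by []. Qed.

Lemma fst_coordD (z z' : R) : fst_coord (z + z') = fst_coord z + fst_coord z'.
Proof. by []. Qed.

Lemma snd_coordD (z z' : R) : snd_coord (z + z') = snd_coord z + snd_coord z'.
Proof. by []. Qed.

Lemma fst_coord0 : fst_coord 0 = 0. Proof. by []. Qed.
Lemma snd_coord0 : snd_coord 0 = 0. Proof. by []. Qed.
Lemma fst_coord1 : fst_coord 1 = 1. Proof. by []. Qed.
Lemma snd_coord1 : snd_coord 1 = 1. Proof. by []. Qed.

Definition coordE := (fst_coordM, snd_coordM, fst_coordD, snd_coordD,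
  (fst_coord0, snd_coord0, fst_coord1, snd_coord1)).

Lemma trichotomous_amalg_dup_base : trichotomous R -> trichotomous A.
Proof.
move=> triR r; have [z [z1 z2]] := amalg_dup_diag r.
have [E [F [G [EFG [EF EG FG] [X EX] zF [zzG ann]]]]] := triR z.
have fstE (w w' : R) : w = w' -> fst_coord w = fst_coord w' by move=> ->.
move: (fstE _ _ EFG) (fstE _ _ EF) (fstE _ _ EG) (fstE _ _ FG).
move: (fstE _ _ EX) (fstE _ _ zF) (fstE _ _ zzG).
rewrite !coordE z1 => ex rf rrg efg ef eg fg.
exists (fst_coord E), (fst_coord F), (fst_coord G).
split=> //; first by exists (fst_coord X).
split=> // y ryg.
(* (r, r) (y, y) G has second coordinate r y g2, which need not vanish; it does
   when y is replaced by y g. *)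
pose y' := y * fst_coord G.
have [w [w1 w2]] := amalg_dup_diag y'.
have [|v vE] := ann w.
  by apply: amalg_dup_inj; rewrite !coordE ?w1 ?w2 ?z1 ?z2 /y' mulrA ryg mul0r.
exists (fst_coord v); have := congr1 fst_coord vE.
rewrite !coordE w1 z1 /y' => <-.
have [_ _ gg] := orthogonal_idem efg ef eg fg.
by rewrite -mulrA gg.
Qed.

(** Write the trichotomy of (0, a) as (0, e), (f1, f2), (g1, g2), where e lies
    in aA.  As (a, 0) annihilates (0, a), on (g1, g2) it is a multiple of
    (0, a), so a g1 = 0.  Then a = a e + a g2 = a (e + (g2 - g1)). *)
Lemma trichotomous_amalg_dup_locally_unital :
  trichotomous R -> locally_unital I.
Proof.
move=> triR a aI; have [|z [z1 z2]] := @amalg_dup_coordP 0 a.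
  by rewrite subr0.
have [E [F [G [EFG [EF EG FG] [X EX] zF [zzG ann]]]]] := triR z.
have [|w [w1 w2]] := @amalg_dup_coordP a 0.
  by apply: ideal_sub => //; exact: (rpred0 I).
have [|y yE] := ann w.
  by apply: amalg_dup_inj; rewrite !coordE ?z1 ?w2 ?mul0r ?mulr0 ?mul0r.
have ag : a * fst_coord G = 0.
  by have := congr1 fst_coord yE; rewrite !coordE w1 z1 mul0r.
have eE : snd_coord E = a * snd_coord X by rewrite EX !coordE z2.
have af : a * snd_coord F = 0.
  by have := congr1 snd_coord zF; rewrite !coordE z2.
have efg : snd_coord E + snd_coord F + snd_coord G = 1.
  by have := congr1 snd_coord EFG; rewrite !coordE.
exists (snd_coord E + (snd_coord G - fst_coord G)).
  apply: ideal_add; last exact: amalg_dup_sub.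
  by rewrite eE ideal_mulr.
by rewrite -[LHS]mulr1 -efg !mulrDr mulrN ag af oppr0 !addr0.
Qed.

(** If a = a b with b in I, then also a = a b ^ 2, and b ^ 2 is fixed by the
    idempotent of the trichotomy of b on which b is invertible. *)
Lemma locally_unital_idem : trichotomous A -> locally_unital I ->
  forall a : A, (a : A^o) \in I ->
  exists h : A, [/\ (h : A^o) \in I, h * h = h & a = a * h].
Proof.
move=> triA unitI a /unitI[b bI ab].
have [e [f [g [efg [ef eg fg] [x ex] bf [bbg _]]]]] := triA b.
have [ee _ _] := orthogonal_idem efg ef eg fg.
exists e; split=> //; first by rewrite ex ideal_mulr.
have abb : a = a * b * b by rewrite -!ab.
have bb : b * b = b * b * e.
  by rewrite -[LHS]mulr1 -efg !mulrDr bbg -(mulrA b b f) bf mulr0 !addr0.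
by rewrite {1}abb -mulrA bb !mulrA -!ab.
Qed.

(** For z = (r, s), take an idempotent h in I with (s - r) h = s - r.  Each
    idempotent u of the trichotomy of r is paired with h u' + (1 - h) u, where
    u' is the corresponding one for s; the pair is in R because h is in I, and
    it works because s = h s + (1 - h) r. *)
Lemma trichotomous_amalg_dup :
  trichotomous A -> locally_unital I -> trichotomous R.
Proof.
move=> triA unitI z; set r := fst_coord z; set s := snd_coord z.
have [h [hI hh sh]] := locally_unital_idem triA unitI (amalg_dup_sub z).
rewrite -/r -/s in sh.
have [e [f [g [efg [ef eg fg] [x ex] rf [rrg ann]]]]] := triA r.
have [e' [f' [g' [efg' [ef' eg' fg'] [x' ex'] sf' [ssg' ann']]]]] := triA s.
have sh' : s * (1 - h) = r * (1 - h).
  apply/eqP; rewrite -subr_eq0; apply/eqP.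
  transitivity ((s - r) - (s - r) * h); first by ring.
  by rewrite -sh subrr.
pose mix u u' := h * u' + (1 - h) * u.
have lift u u' : exists w : R, fst_coord w = u /\ snd_coord w = mix u u'.
  apply: amalg_dup_coordP; rewrite (_ : _ - _ = h * (u' - u)).
    exact: ideal_mulr.
  by rewrite /mix; ring.
have mixM u u' v v' : mix u u' * mix v v' = mix (u * v) (u' * v').
  by rewrite /mix; ring: hh.
have mix0 : mix 0 0 = 0 by rewrite /mix !mulr0 addr0.
have sE : s = mix r s by rewrite /mix [_ * r]mulrC -sh'; ring.
have [E [E1 E2]] := lift e e'; have [F [F1 F2]] := lift f f'.
have [G [G1 G2]] := lift g g'; have [X [X1 X2]] := lift x x'.
exists E, F, G; split.
- apply: amalg_dup_inj; rewrite !coordE ?E1 ?F1 ?G1 // E2 F2 G2.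
  transitivity (mix (e + f + g) (e' + f' + g')); first by rewrite /mix; ring.
  by rewrite efg efg' /mix; ring.
- split; apply: amalg_dup_inj; rewrite !coordE ?E1 ?F1 ?G1 // ?E2 ?F2 ?G2 mixM.
  + by rewrite ef ef'.
  + by rewrite eg eg'.
  + by rewrite fg fg'.
- exists X; apply: amalg_dup_inj; rewrite !coordE ?E1 ?X1 // E2 X2 -/s sE mixM.
  by rewrite -ex -ex'.
- by apply: amalg_dup_inj; rewrite !coordE ?F1 // F2 -/s sE mixM rf sf'.
split.
  by apply: amalg_dup_inj; rewrite !coordE ?G1 // G2 -/s sE !mixM rrg ssg'.
move=> y; set y1 := fst_coord y; set y2 := snd_coord y => zyG.
have ry1 : r * y1 * g = 0.
  by have := congr1 fst_coord zyG; rewrite !coordE G1.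
have sy2 : s * y2 * mix g g' = 0.
  by have := congr1 snd_coord zyG; rewrite !coordE G2.
have [w1 w1E] := ann _ ry1.
have [w' w'E] : exists w, y2 * h * g' = s * w.
  apply: ann'; transitivity (h * (s * y2 * mix g g')).
    by rewrite /mix; ring: hh.
  by rewrite sy2 mulr0.
have [w'' w''E] : exists w, y2 * (1 - h) * g = r * w.
  apply: ann; transitivity ((1 - h) * (s * y2 * mix g g')).
    transitivity (r * (1 - h) * y2 * g); first by ring.
    by rewrite -sh' /mix; ring: hh.
  by rewrite sy2 mulr0.
(* The quotients w1 and w'' of the two coordinates need not agree modulo I.
   Since y2 - y1 = i (y2 - y1) with i in I, w'' can be replaced by
   w1 + i (w'' - w1). *)
have [i iI yi] := unitI _ (amalg_dup_sub y); rewrite -/y1 -/y2 in yi.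
pose w2 := mix (w1 + i * (w'' - w1)) w'.
have [|w [wE1 wE2]] := @amalg_dup_coordP w1 w2.
  rewrite (_ : _ - _ = h * (w' - w1) + i * ((1 - h) * (w'' - w1))).
    by apply: ideal_add; exact: ideal_mulr.
  by rewrite /w2 /mix; ring.
exists w; apply: amalg_dup_inj; rewrite !coordE ?G1 ?wE1 // wE2 G2 -/y2 -/s.
have rw : r * (w1 + i * (w'' - w1)) = y1 * g + i * (y2 * (1 - h) * g - y1 * g).
  by rewrite w1E w''E; ring.
rewrite sE /w2 mixM rw -w'E.
transitivity (mix (y1 * g + (y2 - y1) * g) (y2 * g')).
  by rewrite /mix; ring.
by rewrite {1}yi /mix; ring: hh.
Qed.

End Duplication.

Theorem theorem3p3 (A : comPzRingType) (I : submodClosed A^o) :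
  one_semiregular (amalg_dup I) <-> pure_ideal I /\ one_semiregular A.
Proof.
split=> [semiR|[pureI semiA]].
  have triR := one_semiregular_trichotomous semiR.
  split.
    exact/locally_unital_pure_ideal/trichotomous_amalg_dup_locally_unital.
  exact/trichotomous_one_semiregular/(trichotomous_amalg_dup_base triR).
apply/trichotomous_one_semiregular/trichotomous_amalg_dup.
  exact: one_semiregular_trichotomous.
exact: pure_ideal_locally_unital.
Qed.
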